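(* Let $A$ be a simple Artinian ring and let $(P,R)$ be an invariant prime of $A$, where $R$ is a Goldie ring. For $I\in\mathcal{F}(R)$ let $v(I)=\{a\in A\mid aI\subseteq P\}$ and let $\Gamma=\{v(I)\mid I\in\mathcal{F}(R)\}$, with the operation $v(I)+v(J)=v(IJ)$. If $\Gamma$ is a group and $\bigcap_{n\geq 1} P^{n}=0$, then $R$ is a valuation ring (of $A$) and $A$ is a skewfield.
   Context: A prime in a ring $A$ is a pair $(P,R)$ where $R$ is a subring of $A$ and $P\subset R$ is a prime ideal of $R$ such that for all $x,y\in A$, $xRy\subseteq P$ implies $x\in P$ or $y\in P$. It is strict fractional if for every $r\neq 0$ in $A$ there are $x,y\in R$ with $0\neq xry\in R$. Put $A^{P}=\{a\in A\mid aP\subseteq P\text{ and }Pa\subseteq P\}$. A ring is Goldie if its set $S$ of regular elements satisfies the Ore condition and its localization at $S$ is semisimple Artinian. An invariant prime of a simple Artinian ring $A$ is a strict fractional prime $(P,R)$ of $A$ with $R=A^{P}$, $R$ Goldie (so that $R$ is a prime ring and an order in $A$), and $P$ invariant under all inner automorphisms of $A$ (i.e. $uPu^{-1}\subseteq P$ for all units $u$ of $A$). A fractional $R$-ideal of $A$ is an $R$-bimodule $I\subseteq A$ which contains a regular element of $R$ and satisfies $rI\subseteq R$ for some regular $r\in R$; $\mathcal{F}(R)$ is the set of fractional $R$-ideals. The operation $+$ on $\Gamma$ is well defined with neutral element $v(R)=P$, and $\Gamma$ is totally ordered by $v(I)\leq v(J)\Leftrightarrow v(I)\subseteq v(J)$.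 A valuation ring of a skewfield $A$ is a subring $R$, invariant under inner automorphisms of $A$, such that for every nonzero $a\in A$ one has $a\in R$ or $a^{-1}\in R$.
   Formalization: The formal theorem adds the hypothesis P ≠ 0; without it the claim fails, e.g. for A = M₂(k) with (P,R) = (0,A), which meets every stated hypothesis although A is not a skewfield. *)

(* Defs.v *)
From mathcomp Require Import all_boot all_order all_algebra.
From mathcomp Require Import boolp classical_sets.

Set Implicit Arguments.
Unset Strict Implicit.
Unset Printing Implicit Defensive.

Import GRing.Theory.
Local Open Scope classical_set_scope.
Local Open Scope ring_scope.

(* Subsets of a ring A are classical sets [set A]; [[in X]] is the same subset
   seen as a (classically decided) boolean predicate, the form expected by the
   library predicates [GRing.zmod_closed] and [GRing.subring_closed]. *)

Section RingNotions.
Variable A : nzRingType.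
Implicit Types (I J P R S : set A).

Definition left_ideal I : Prop :=
  GRing.zmod_closed [in I] /\ (forall a x, I x -> I (a * x)).

Definition right_ideal I : Prop :=
  GRing.zmod_closed [in I] /\ (forall a x, I x -> I (x * a)).

(* [A] is nonzero because it is a [nzRingType]. *)
Definition simple_ring : Prop :=
  forall I, left_ideal I -> right_ideal I -> I = [set 0] \/ I = setT.

Definition dcc (D : set A -> Prop) : Prop :=
  forall I : nat -> set A, (forall n, D (I n)) ->
    (forall n, I n.+1 `<=` I n) ->
    exists N, forall n, (N <= n)%N -> I n = I N.

Definition artinian_ring : Prop := dcc left_ideal /\ dcc right_ideal.

(* Every submodule of the left regular module is a direct summand; this notion
   is left-right symmetric. *)
Definition semisimple_ring : Prop :=
  forall I, left_ideal I -> exists J,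
    [/\ left_ideal J, I `&` J = [set 0] &
        forall a, exists x y, [/\ I x, J y & a = x + y]].

Definition sub_bimodule R I : Prop :=
  GRing.zmod_closed [in I] /\
  (forall r x, R r -> I x -> I (r * x) /\ I (x * r)).

Definition prime_ideal_of R P : Prop :=
  [/\ P `<=` R, P <> R, sub_bimodule R P &
      forall x y, R x -> R y ->
        (forall r, R r -> P (x * r * y)) -> P x \/ P y].

Definition prime_pair P R : Prop :=
  [/\ GRing.subring_closed [in R], prime_ideal_of R P &
      forall x y : A, (forall r, R r -> P (x * r * y)) -> P x \/ P y].

Definition strict_fractional R : Prop :=
  forall r : A, r != 0 ->
    exists x y, [/\ R x, R y, x * r * y != 0 & R (x * r * y)].

(* A^P *)
Definition idealizer P : set A :=
  [set a | (forall p, P p -> P (a * p)) /\ (forall p, P p -> P (p * a))].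

(* Regularity is relative to [R], not to the ambient ring [A]. *)
Definition regular_elements R : set A :=
  [set s | R s /\ forall r, R r -> (s * r = 0 -> r = 0) /\ (r * s = 0 -> r = 0)].

Definition ore_condition R S : Prop :=
  forall r s, R r -> S s ->
    (exists r' s', [/\ R r', S s' & r * s' = s * r']) /\
    (exists r' s', [/\ R r', S s' & s' * r = r' * s]).

(* [f] presents [Q] as the (two-sided) ring of fractions of the subring [R] at
   [S]. Only the values of [f] on [R] are relevant. *)
Definition is_localization R S (Q : unitRingType) (f : A -> Q) : Prop :=
  [/\ f 1 = 1,
      (forall x y, R x -> R y -> f (x + y) = f x + f y /\ f (x * y) = f x * f y),
      (forall s, S s -> f s \is a GRing.unit),
      (forall q, (exists r s, [/\ R r, S s & q = f r * (f s)^-1]) /\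
                 (exists r s, [/\ R r, S s & q = (f s)^-1 * f r])) &
      (forall r, R r -> f r = 0 ->
         (exists2 s, S s & r * s = 0) /\ (exists2 s, S s & s * r = 0))].

Definition set_mul I J : set A :=
  [set a | exists2 s : seq (A * A),
     (forall p, p \in s -> I p.1 /\ J p.2) & a = \sum_(p <- s) p.1 * p.2].

(* P^n for n >= 1; only these exponents are used. *)
Definition set_pow P (n : nat) : set A := iter n.-1 (set_mul P) P.

Definition fractional_ideal R : set (set A) :=
  [set I | [/\ sub_bimodule R I,
               exists2 c, I c & regular_elements R c &
               exists2 r, regular_elements R r & forall x, I x -> R (r * x)]].

Definition v P I : set A := [set a | forall x, I x -> P (a * x)].

Definition Gamma P R : set (set A) := [set v P I | I in fractional_ideal R].

End RingNotions.

Definition goldie (A : nzRingType) (R : set A) : Prop :=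
  let S := regular_elements R in
  ore_condition R S /\
  exists (Q : unitRingType) (f : A -> Q),
    [/\ is_localization R S f, semisimple_ring Q & artinian_ring Q].

Definition group_on (T : Type) (G : set T) (op : T -> T -> T) : Prop :=
  [/\ (forall x y, G x -> G y -> G (op x y)),
      (forall x y z, G x -> G y -> G z -> op x (op y z) = op (op x y) z) &
      exists e, [/\ G e, (forall x, G x -> op e x = x /\ op x e = x) &
        forall x, G x -> exists y, [/\ G y, op x y = e & op y x = e]]].

Definition Gamma_is_group (A : nzRingType) (P R : set A) : Prop :=
  exists add : set A -> set A -> set A,
    (forall I J, fractional_ideal R I -> fractional_ideal R J ->
       add (v P I) (v P J) = v P (set_mul I J)) /\
    group_on (Gamma P R) add.

Definition inner_invariant (A : unitRingType) (X : set A) : Prop :=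
  forall u x, u \is a GRing.unit -> X x -> X (u * x * u^-1).

Definition invariant_prime (A : unitRingType) (P R : set A) : Prop :=
  [/\ prime_pair P R, strict_fractional R, R = idealizer P, goldie R &
      inner_invariant P].

Definition skewfield (A : unitRingType) : Prop := GRing.field_axiom A.

(* The ambient ring is required to be a skewfield separately. *)
Definition valuation_ring (A : unitRingType) (R : set A) : Prop :=
  [/\ GRing.subring_closed [in R], inner_invariant R &
      forall a, a != 0 -> R a \/ R a^-1].

(* Main.v *)
Require Import Defs.
From mathcomp Require Import all_boot all_order all_algebra.
From mathcomp Require Import boolp classical_sets.

(**
A unit u of A satisfies uPu^-1 = P, so if neither u nor u^-1 lies in R = A^P
there are p, q in P with pu and u^-1q outside P, whereas
(pu)R(u^-1q) = p(uRu^-1)q = pRq lies in P: this contradicts primeness. Hence R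
contains u or u^-1 for every unit u. Applied to u = 1 + x, u^-1 = 1 - x, this
puts every square-zero x in R. If e were an idempotent other than 0 and 1, then
eA(1-e) and (1-e)Ae would consist of square-zero elements, and by simplicity
these two corners generate A as a ring, so that R = A and P would be a
nonzero proper ideal of A. A simple Artinian ring without nontrivial idempotents is a
skewfield.
*)

Import GRing.Theory.
Local Open Scope classical_set_scope.
Local Open Scope ring_scope.

Lemma zmod_closedP (A : nzRingType) (I : set A) :
  GRing.zmod_closed [in I] <-> I 0 /\ (forall x y, I x -> I y -> I (x - y)).
Proof.
split=> -[I0 IB]; split.
- by rewrite inE in I0.
- by move=> x y /mem_set Ix /mem_set Iy; apply: set_mem; apply: IB.
- by rewrite inE.
- by move=> x y; rewrite !inE; apply: IB.
Qed.

Lemma subring_closedP (A : nzRingType) (R : set A) :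
  GRing.subring_closed [in R] ->
  [/\ R 1, (forall x y, R x -> R y -> R (x - y)) &
      (forall x y, R x -> R y -> R (x * y))].
Proof.
case=> R1 RB RM; split; first by rewrite inE in R1.
  by move=> x y /mem_set Rx /mem_set Ry; apply: set_mem; apply: RB.
by move=> x y /mem_set Rx /mem_set Ry; apply: set_mem; apply: RM.
Qed.

(** Without a minimal member, choice yields [g] sending each member of [D] to a strictly smaller
    one; iterating [g] from [I0] gives a chain that never stabilizes. *)
Lemma dcc_minimal (A : nzRingType) (D : set A -> Prop) (I0 : set A) :
  dcc D -> D I0 ->
  exists2 M, D M & forall J, D J -> J `<=` M -> J = M.
Proof.
move=> dccD DI0; apply: contrapT => noM.
have /choice[g gP] (M : set A) :
    exists J, D M -> [/\ D J, J `<=` M & J <> M].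
  have [DM|nDM] := pselect (D M); last by exists M.
  apply: contrapT => noJ; apply: noM; exists M => // J DJ JM.
  by apply: contrapT => JneM; apply: noJ; exists J.
have DI n : D (iter n g I0) by elim: n => //= n /gP[].
have [n|N stab] := dccD _ DI; first by case: (gP _ (DI n)).
by case: (gP _ (DI N)) => _ _; apply; apply: (stab N.+1).
Qed.

(** This and the next lemma treat the image and the kernel of right multiplication by [b], a
    left-linear map on [L], in preparation for a Schur-type argument. *)
Lemma left_ideal_image (A : nzRingType) (L : set A) (b : A) :
  left_ideal L -> left_ideal [set x * b | x in L].
Proof.
case=> /zmod_closedP[L0 LB] LM; split.
  apply/zmod_closedP; split; first by exists 0; rewrite ?mul0r.
  move=> _ _ [x Lx <-] [y Ly <-]; exists (x - y); first exact: LB.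
  by rewrite mulrBl.
by move=> a _ [x Lx <-]; exists (a * x); [exact: LM | rewrite mulrA].
Qed.

Lemma left_ideal_ann (A : nzRingType) (L : set A) (b : A) :
  left_ideal L -> left_ideal [set x | L x /\ x * b = 0].
Proof.
case=> /zmod_closedP[L0 LB] LM; split.
  apply/zmod_closedP; split; first by split; rewrite ?mul0r.
  move=> x y [Lx xb] [Ly yb]; split; first exact: LB.
  by rewrite mulrBl xb yb subrr.
by move=> a x [Lx xb]; split; [exact: LM | rewrite -mulrA xb mulr0].
Qed.

(** The [y] with [yAz = 0] form a two-sided ideal; as it contains [x != 0], it contains 1. *)
Lemma simple_left_annihilator (A : nzRingType) (x z : A) :
  simple_ring A -> x != 0 -> (forall a, x * a * z = 0) -> z = 0.
Proof.
move=> A_simple x0 xAz.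
pose J : set A := [set y | forall a, y * a * z = 0].
have Jz : GRing.zmod_closed [in J].
  apply/zmod_closedP; split; first by move=> a; rewrite !mul0r.
  by move=> y t Jy Jt a; rewrite !mulrBl Jy Jt subrr.
case: (A_simple J).
- by split=> // b y Jy a; rewrite -!mulrA [y * _]mulrA Jy mulr0.
- by split=> // b y Jy a; rewrite -[y * b * a]mulrA; apply: Jy.
- by move=> J0; have := xAz : J x; rewrite J0 => /eqP; rewrite (negbTE x0).
- move=> JT; have : J 1 by rewrite JT.
  by move=> /(_ 1); rewrite !mul1r.
Qed.

(** Brauer's argument: a minimal nonzero left ideal [L] with nonzero square contains a nonzero
    idempotent. Here it must be 1, so [L] is all of [A], and minimality makes every nonzero element
    left invertible. *)
Lemma idempotent_free_skewfield (A : unitRingType) :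
  simple_ring A -> dcc (@left_ideal A) ->
  (forall e : A, e * e = e -> e = 0 \/ e = 1) -> skewfield A.
Proof.
move=> A_simple dccA idem.
pose D (I : set A) := left_ideal I /\ exists2 x, I x & x != 0.
have DT : D setT.
  split; last by exists 1; rewrite ?oner_neq0.
  by split=> //; apply/zmod_closedP.
have dccD : dcc D by move=> I DI; apply: dccA => n; case: (DI n).
have [L [Lideal [b Lb b0]] Lmin] := dcc_minimal _ _ _ dccD DT.
have [/zmod_closedP[L0 LB] LM] := Lideal.
(* Simplicity forbids [bAb = 0], so some [c = a * b] works. *)
have [c Lc bc0] : exists2 c, L c & b * c != 0.
  apply: contrapT => noc; case/eqP: (b0).
  apply: (simple_left_annihilator _ _ _ A_simple b0) => a.
  rewrite -mulrA; apply: contrapT => /eqP h.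
  by apply: noc; exists (a * b) => //; apply: LM.
(* By minimality of [L], right multiplication by [c] is onto [L], and then ([ann0]) injective on
   it. *)
have Lc_eq : [set x * c | x in L] = L.
  apply: Lmin; last by move=> _ [x _ <-]; apply: LM.
  by split; [exact: left_ideal_image | exists (b * c) => //; exists b].
have ann0 x : L x -> x * c = 0 -> x = 0.
  move=> Lx xc; apply: contrapT => /eqP x0.
  have : [set x | L x /\ x * c = 0] = L.
    apply: Lmin; last by move=> y [].
    by split; [exact: left_ideal_ann | exists x].
  move=> annL; have [_ bc] : [set x | L x /\ x * c = 0] b by rewrite annL.
  by rewrite bc eqxx in bc0.
(* The preimage [e] of [c] is idempotent, because [(e * e - e) * c = 0]. *)
have [e Le ec] : [set x * c | x in L] c by rewrite Lc_eq.
have ee : e * e = e.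
  apply/eqP; rewrite -subr_eq0; apply/eqP; apply: ann0.
    by apply: LB => //; apply: LM.
  by rewrite mulrBl -mulrA ec ec subrr.
have e1 : e = 1.
  case: (idem e ee) => // e0; move: bc0.
  by rewrite -ec e0 mul0r mulr0 eqxx.
have LT x : L x by rewrite -[x]mulr1 -e1; apply: LM.
have left_inv (x : A) : x != 0 -> exists y, y * x = 1.
  move=> x0; have LxL : [set y * x | y in L] = L.
    apply: Lmin => //; split; first exact: left_ideal_image.
    by exists x => //; exists 1; rewrite ?mul1r.
  have [y _ yx] : [set y * x | y in L] 1 by rewrite LxL.
  by exists y.
move=> x x0; have [y yx] := left_inv x x0.
(* The left inverse [y] has a left inverse [z] of its own, and [z = z * (y * x) = x]. *)
have [z zy] : exists z, z * y = 1.
  by apply: left_inv; apply: contra_eq_neq yx => ->; rewrite mul0r eq_sym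
    oner_eq0.
have zx : z = x by rewrite -[z]mulr1 -yx mulrA zy mul1r.
by apply/unitrP; exists y; split=> //; rewrite -zx.
Qed.

Lemma idealizer_conj (A : unitRingType) (P : set A) :
  inner_invariant P -> inner_invariant (idealizer P).
Proof.
move=> Pinv u x Uu [xP Px].
(* Invariance at [u^-1] lets one conjugate [p] back, multiply by [x] inside [P], and conjugate
   forward. *)
have Pinv' p : P p -> P (u^-1 * p * u).
  by move=> /(Pinv u^-1 p); rewrite invrK unitrV; apply.
split=> p /Pinv' Pp.
  have := Pinv u _ Uu (xP _ Pp).
  by rewrite !mulrA mulrK.
have := Pinv u _ Uu (Px _ Pp).
by rewrite !mulrA mulrV // mul1r.
Qed.

Lemma idealizer_or_inv (A : unitRingType) (P : set A) (u : A) :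
  prime_pair P (idealizer P) -> inner_invariant P -> u \is a GRing.unit ->
  idealizer P u \/ idealizer P u^-1.
Proof.
move=> [_ [PR _ _ _] Pprime] Pinv Uu.
(* For a unit, stability of [P] on one side suffices: [w * p] is the conjugate of [p * w] by [w]. *)
have idealizer_of_right w : w \is a GRing.unit ->
    (forall p, P p -> P (p * w)) -> idealizer P w.
  move=> Uw Pw; split=> // p /Pw /(Pinv w _ Uw).
  by rewrite mulrA mulrK.
have idealizer_of_left w : w \is a GRing.unit ->
    (forall p, P p -> P (w * p)) -> idealizer P w.
  move=> Uw wP; split=> // p /wP /(Pinv w^-1).
  by rewrite invrK unitrV mulKr //; apply.
apply: contrapT => /not_orP[nu nv].
have [p Pp Ppu] : exists2 p, P p & ~ P (p * u).
  apply: contrapT => nop; apply: nu; apply: idealizer_of_right => // p Pp.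
  by apply: contrapT => Ppu; apply: nop; exists p.
have [q Pq Pvq] : exists2 q, P q & ~ P (u^-1 * q).
  apply: contrapT => noq; apply: nv; apply: idealizer_of_left => [|q Pq].
    by rewrite unitrV.
  by apply: contrapT => Pvq; apply: noq; exists q.
case: (Pprime (p * u) (u^-1 * q)) => // r Rr.
have -> : p * u * r * (u^-1 * q) = p * ((u * r * u^-1) * q).
  by rewrite !mulrA.
have [urP _] := idealizer_conj _ _ Pinv u r Uu Rr.
by case: (PR p Pp) => pP _; apply/pP/urP.
Qed.

Lemma idealizer_square_zero (A : unitRingType) (P : set A) (x : A) :
  prime_pair P (idealizer P) -> inner_invariant P -> x * x = 0 ->
  idealizer P x.
Proof.
move=> PR Pinv xx; have [/subring_closedP[R1 RB _] _ _] := PR.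
have xl : (1 - x) * (1 + x) = 1.
  by rewrite mulrBl mul1r mulrDr mulr1 xx addr0 addrK.
have xr : (1 + x) * (1 - x) = 1.
  by rewrite mulrBr mulr1 mulrDl mul1r xx addr0 addrK.
have Ux : 1 + x \is a GRing.unit by apply/unitrP; exists (1 - x).
have xV : (1 + x)^-1 = 1 - x by apply: (mulrI Ux); rewrite mulrV.
case: (idealizer_or_inv _ _ _ PR Pinv Ux) => [Rx|].
  by rewrite -[x](addKr 1) addrC; apply: RB.
by rewrite xV => Rx; rewrite -[x](subKr 1); apply: RB.
Qed.

(** The [z] with [eAzAe] inside [R] form a two-sided ideal. It contains [f], since
    [exfye = (exf)(fye)], hence also 1. *)
Lemma corner_subset (A : nzRingType) (R : set A) (e f : A) :
  simple_ring A -> GRing.subring_closed [in R] -> f != 0 -> f * f = f ->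
  (forall a, R (e * a * f)) -> (forall a, R (f * a * e)) ->
  forall a, R (e * a * e).
Proof.
move=> A_simple /subring_closedP[R1 RB RM] f0 ff Ref Rfe a.
pose J : set A := [set z | forall x y, R (e * x * z * y * e)].
have Jz : GRing.zmod_closed [in J].
  apply/zmod_closedP; split.
    by move=> x y; rewrite mulr0 !mul0r -(subrr 1); apply: RB.
  by move=> z t Jz Jt x y; rewrite mulrBr !mulrBl; apply: RB.
have Jf : J f.
  move=> x y; rewrite -{1}ff.
  have -> : e * x * (f * f) * y * e = (e * x * f) * (f * y * e).
    by rewrite !mulrA.
  exact: RM.
case: (A_simple J).
- by split=> // b z Jb x y; rewrite mulrA -[e * x * b]mulrA; apply: Jb.
- by split=> // b z Jb x y; rewrite mulrA -[_ * b * y]mulrA; apply: Jb.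
- by move=> J0; move: Jf; rewrite J0 => /eqP; rewrite (negbTE f0).
- move=> JT; have : J 1 by rewrite JT.
  by move=> /(_ a 1); rewrite !mulr1.
Qed.

Lemma prime_pair_proper (A : nzRingType) (P R : set A) :
  simple_ring A -> prime_pair P R -> P <> [set 0] -> R <> setT.
Proof.
move=> A_simple [_ [_ PneR [PB Pbi] _] _] P0 RT; rewrite RT in PneR Pbi.
by case: (A_simple P) => //; split=> // a x Px; case: (Pbi a x).
Qed.

Lemma prime_pair_idempotent (A : unitRingType) (P : set A) (e : A) :
  simple_ring A -> prime_pair P (idealizer P) -> inner_invariant P ->
  P <> [set 0] -> e * e = e -> e = 0 \/ e = 1.
Proof.
move=> A_simple PR Pinv P0 ee; apply: contrapT => /not_orP[/eqP e0 /eqP e1].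
have [Rsub _ _] := PR; have /subring_closedP[R1 RB _] := Rsub.
apply: (prime_pair_proper _ _ _ A_simple PR P0).
set f := 1 - e.
have f0 : f != 0 by rewrite subr_eq0 eq_sym.
have ef : e * f = 0 by rewrite mulrBr mulr1 ee subrr.
have fe : f * e = 0 by rewrite mulrBl mul1r ee subrr.
have ff : f * f = f by rewrite {1}/f mulrBl mul1r ef subr0.
(* The square of [g * a * h] contains the factor [h * g = 0]. *)
have corner g h : h * g = 0 -> forall a, idealizer P (g * a * h).
  move=> hg a; apply: idealizer_square_zero => //.
  by rewrite mulrA -[g * a * h * _]mulrA [h * (g * a)]mulrA hg mul0r mulr0
    mul0r.
have Ref := corner e f fe; have Rfe := corner f e ef.
have Ree := corner_subset _ _ _ _ A_simple Rsub f0 ff Ref Rfe.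
have Rff := corner_subset _ _ _ _ A_simple Rsub e0 ee Rfe Ref.
have RD x y : idealizer P x -> idealizer P y -> idealizer P (x + y).
  move=> Rx Ry; rewrite -[y]opprK -[- y]sub0r; apply: (RB) => //.
  by apply: (RB) => //; rewrite -(subrr 1); apply: RB.
rewrite -subTset => a _.
(* Peirce decomposition of [a] along [1 = e + f]. *)
have -> : a = (e * a * e + e * a * f) + (f * a * e + f * a * f).
  by rewrite -!mulrDr -!mulrDl -?mulrDr /f [e + _]addrC subrK mul1r mulr1.
by apply: (RD); apply: RD.
Qed.

Theorem theorem3p4 (A : unitRingType) (P R : set A)
  (A_simple : simple_ring A) (A_artinian : artinian_ring A)
  (PR_invariant : invariant_prime P R) (R_goldie : goldie R)
  (P_nonzero : P <> [set 0])
  (Gamma_group : Gamma_is_group P R)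
  (P_powers : \bigcap_(n >= 1) set_pow P n = [set 0]) :
  valuation_ring R /\ skewfield A.
Proof.
have [PR _ RE _ Pinv] := PR_invariant; have [dccA _] := A_artinian.
subst R.
have A_field : skewfield A.
  apply: idempotent_free_skewfield => // e.
  exact: prime_pair_idempotent PR Pinv P_nonzero.
split=> //; split; first by case: PR.
  exact: idealizer_conj.
by move=> a /A_field; apply: idealizer_or_inv.
Qed.
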